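(* Let $\Omega,\Lambda\subset\{1,\dots,N\}$ with $|\Omega|=n$ and $|\Lambda|=s$, let $0<\epsilon<1$ and $0<\delta<1$. Let $b\in\mathbb{R}^N$ and $c\in\mathbb{R}^{2N-1}$ be random vectors with independent Bernoulli $\pm1$ entries, and let $A$ denote either $\frac1{\sqrt n}S^b_\Omega$ or $\frac1{\sqrt n}T^c_\Omega$. Assume $$ n\ge \tilde C\,\delta^{-2}s\log^2(4s/\epsilon),\qquad \tilde C=4\pi^2.$$ Then with probability at least $1-\epsilon$ the minimal and maximal eigenvalues $\lambda_{\min},\lambda_{\max}$ of $A_\Lambda^*A_\Lambda$ satisfy $$1-\delta\le\lambda_{\min}\le\lambda_{\max}\le 1+\delta.$$
   Context: For $b=(b_0,\dots,b_{N-1})\in\mathbb{R}^N$ the circulant matrix $S^b\in\mathbb{R}^{N\times N}$ has entries $S^b_{i,j}=b_{(j-i)\bmod N}$, $i,j=1,\dots,N$. For $c=(c_{-N+1},\dots,c_{N-1})\in\mathbb{R}^{2N-1}$ the Toeplitz matrix $T^c\in\mathbb{R}^{N\times N}$ has entries $T^c_{i,j}=c_{j-i}$. $S^b_\Omega$ (resp. $T^c_\Omega$) is the submatrix consisting of the rows indexed by $\Omega$. A Bernoulli $\pm1$ variable takes values $\pm1$ with probability $1/2$ each. $A_\Lambda$ denotes the submatrix of $A$ consisting of the columns indexed by $\Lambda$. *)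

(* Defs.v *)
From HB Require Import structures.
From mathcomp Require Import all_boot all_order all_algebra.
From mathcomp Require Import all_classical all_reals all_analysis.
Set Implicit Arguments. Unset Strict Implicit. Unset Printing Implicit Defensive.
Import Order.TTheory GRing.Theory Num.Theory.
Local Open Scope ring_scope.

(* Sign of a Bernoulli +-1 entry: a bool x encodes (-1)^x.  Entry k of a
   sign vector v : {ffun 'I_m -> bool} read at a natural index k (0 if out
   of range, which never happens in the uses below). *)
Definition sgn_at (R : ringType) (m : nat) (v : {ffun 'I_m -> bool}) (k : nat) : R :=
  match @insub nat (fun k => k < m)%N _ k with
  | Some o => (-1) ^+ v o
  | None => 0
  end.

Definition circulant (R : ringType) (N : nat) (b : {ffun 'I_N -> bool}) : 'M[R]_N :=
  \matrix_(i < N, j < N) sgn_at R b ((j + N - i) %% N)%N.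

(* Toeplitz matrix T^c with c = (c_{-N+1},...,c_{N-1}) stored as
   c' : 'I_(2N-1) -> bool with c'_(k + N - 1) = c_k, so T^c_{i,j} = c_{j-i}. *)
Definition toeplitz (R : ringType) (N : nat) (c : {ffun 'I_(N.*2.-1) -> bool}) : 'M[R]_N :=
  \matrix_(i < N, j < N) sgn_at R c (j + N.-1 - i)%N.

Definition submx_scaled (R : realType) (N n : nat) (M : 'M[R]_N)
  (Om La : {set 'I_N}) : 'M[R]_(#|Om|, #|La|) :=
  \matrix_(i < #|Om|, j < #|La|) ((Num.sqrt (n%:R : R))^-1 * M (enum_val i) (enum_val j)).

(* All eigenvalues of the (real symmetric) matrix A_La^* A_La lie in
   [1-delta, 1+delta], i.e. 1-delta <= lambda_min <= lambda_max <= 1+delta. *)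
Definition eig_in_band (R : realType) (p q : nat) (A : 'M[R]_(p, q)) (delta : R) : Prop :=
  forall a : R, eigenvalue (A^T *m A) a -> 1 - delta <= a <= 1 + delta.

(* Probability of an event under independent uniform Bernoulli +-1 entries,
   i.e. the uniform distribution on {ffun 'I_m -> bool}. *)
Definition bern_prob (R : realType) (m : nat) (E : pred {ffun 'I_m -> bool}) : R :=
  (#|[set x | E x]|%:R) / (#|{: {ffun 'I_m -> bool}}|%:R).

(* Main.v *)
Require Import Defs.
From HB Require Import structures.
From mathcomp Require Import all_boot all_order all_algebra.
From mathcomp Require Import all_classical all_reals all_analysis.
From mathcomp Require Import spectral complex.
From mathcomp Require Import ring lra zify.
Set Implicit Arguments. Unset Strict Implicit. Unset Printing Implicit Defensive.
Import Order.TTheory GRing.Theory Num.Theory.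
Local Open Scope ring_scope.

(** Only one property of the circulant and Toeplitz patterns matters: the
    entry [(i, j)] is a sign [b_(kappa i j)] where [kappa] is injective in each
    variable.  Then [A^T A - 1 = X / n], where [X] is a homogeneous quadratic
    chaos with zero diagonal, and by Markov's inequality it suffices to bound
    [E tr X^(2p)] for [p] about [ln(4s/eps) / 2].

    No decoupling is needed.  Let [D_k] be the derivative of [X] in [b_k].
    Euler's identity [2 X = sum_k b_k D_k] and integration by parts in each sign
    give [2 E tr X^(2p) <= (2p-1) E sum_k tr (D_k^2 X^(2p-2))].  Writing
    [D_k = H_k + H_k^T], one has
    [sum_k H_k H_k^T = n (s-1) + (s-2) X], while [sum_k H_k^T H_k] is the Gram
    matrix of a linear Rademacher series, whose moments follow from the same
    integration by parts together with Schur's test.  Young's inequality on the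
    joint spectrum closes the estimate into [E tr X^(2p) <= s (4 p^2 n s)^p]. *)

(** * Joint spectral resolution of traces *)

Section Spectral.
Local Open Scope sesquilinear_scope.

(** The spectral theorem applies to the complexification, which is Hermitian and so has real
    eigenvalues. One pair [U], [d] serves all powers. *)
Lemma symmetric_spectral (R : rcfType) (n : nat) (A : 'M[R]_n) : A^T = A ->
  exists (U : 'M[R[i]]_n) (d : 'I_n -> R),
    [/\ U *m U^t* = 1%:M, U^t* *m U = 1%:M & forall q,
      map_mx (real_complex R) (A ^+ q)
      = U^t* *m diag_mx (\row_j (real_complex R (d j ^+ q))) *m U].
Proof.
move=> symA; pose AC := map_mx (real_complex R) A.
have herm : AC \is hermsymmx.
  apply/is_hermitianmxP; rewrite expr0 scale1r; apply/matrixP => i j.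
  rewrite !mxE -[in LHS]symA mxE.
  by apply/esym/CrealP; rewrite complex_real.
have := hermitian_spectral_diag_real herm.
have /orthomx_spectralP := hermitian_normalmx herm.
set U := spectralmx AC; set e := spectral_diag AC => eA /mxOverP ereal.
have Uu : U \is unitarymx by exact: spectral_unitarymx.
have UU : U *m U^t* = 1%:M by apply/unitarymxP.
have UU' : U^t* *m U = 1%:M by apply: mulmx1C.
exists U, (fun j => complex.Re (e 0 j)); split=> // q.
elim: q => [|q IHq].
  rewrite expr0 map_mx1.
  suff -> : diag_mx (\row_j real_complex R (complex.Re (e 0 j) ^+ 0)) = 1%:M.
    by rewrite mulmx1 UU'.
  by apply/matrixP => i j; rewrite !mxE expr0.
rewrite exprS map_mxM IHq -/AC {1}eA invmx_unitary //.
rewrite !mulmxA -(mulmxA _ U (U^t*)) UU mulmx1; congr (_ *m _).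
rewrite -mulmxA; congr (_ *m _); rewrite mulmx_diag.
congr diag_mx; apply/rowP => j; rewrite !mxE exprS rmorphM.
by congr (_ * _); have /complex_realP [x ->] := ereal 0 j.
Qed.

(** With [F = U G^T], the diagonal matrix equals [F F^*], so each [d j] is a squared row norm. *)
Lemma gram_spectral_ge0 (R : rcfType) (m n : nat) (G : 'M[R]_(m, n))
    (U : 'M[R[i]]_n) (d : 'I_n -> R) :
  U *m U^t* = 1%:M ->
  map_mx (real_complex R) (G^T *m G)
    = U^t* *m diag_mx (\row_j (real_complex R (d j))) *m U ->
  forall j, 0 <= d j.
Proof.
move=> UU eG j; pose F := U *m map_mx (real_complex R) G^T.
have FF : F *m F^t* = diag_mx (\row_j (real_complex R (d j))).
  have -> : F^t* = map_mx (real_complex R) G *m U^t*.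
    rewrite /F !trmx_mul !map_mxM; congr (_ *m _).
    by apply/matrixP => k l; rewrite !mxE; apply/CrealP; rewrite complex_real.
  rewrite /F mulmxA -(mulmxA U) -map_mxM eG !mulmxA UU mul1mx.
  by rewrite -mulmxA UU mulmx1.
have /matrixP/(_ j j) := FF; rewrite !mxE eqxx mulr1n => e.
rewrite -lecR -e; apply: sumr_ge0 => k _.
by rewrite !mxE mul_conjC_ge0.
Qed.

(** The weights are the squared moduli of the entries of [V H U^*], independent of the exponents.
    Scalar inequalities between monomials in [a j] and [b i] thus pass to traces, even when [A] and
    [B] do not commute. *)
Lemma mxtrace_joint_spectral (R : rcfType) (m n : nat) (A : 'M[R]_m)
    (B : 'M[R]_n) (H : 'M[R]_(n, m)) : A^T = A -> B^T = B ->
  exists (w : 'I_n -> 'I_m -> R) (a : 'I_m -> R) (b : 'I_n -> R),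
    [/\ (forall i j, 0 <= w i j),
        (forall k (G : 'M[R]_(k, n)), B = G^T *m G -> forall i, 0 <= b i) &
        forall q r, \tr (H *m (A ^+ q) *m H^T *m (B ^+ r))
    = \sum_i \sum_j w i j * (a j ^+ q * b i ^+ r)].
Proof.
move=> /symmetric_spectral[U [a [_ _ eA]]] /symmetric_spectral[V [b [VV _ eB]]].
pose G := V *m map_mx (real_complex R) H *m U^t*.
pose w i j := complex.Re (G i j) ^+ 2 + complex.Im (G i j) ^+ 2.
exists w, a, b; split=> [i j|k G' eG|q r]; first by rewrite addr_ge0 ?sqr_ge0.
  apply: (gram_spectral_ge0 (G := G') VV).
  by rewrite -eG -[B in LHS]expr1 eB; under eq_mx do rewrite expr1.
apply: (@complexI R); rewrite -[LHS](trace_map_mx (real_complex R)).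
have GT : G^t* = U *m map_mx (real_complex R) H^T *m V^t*.
  rewrite /G !trmx_mul !map_mxM trmxCK mulmxA; congr (_ *m _ *m _).
  by apply/matrixP => i j; rewrite !mxE; apply/CrealP; rewrite complex_real.
set D := diag_mx (\row_j real_complex R (a j ^+ q)).
set E := diag_mx (\row_i real_complex R (b i ^+ r)).
transitivity (\tr (G *m D *m G^t* *m E)).
  by rewrite !map_mxM eA eB GT /G !mulmxA mxtrace_mulC !mulmxA.
clearbody G; rewrite rmorph_sum; apply: eq_bigr => i _.
rewrite rmorph_sum mul_mx_diag !mxE.
rewrite mulr_suml; apply: eq_bigr => j _.
rewrite mul_mx_diag !mxE /w 2!rmorphM/= add_Re2_Im2.
by rewrite normCK; ring.
Qed.

End Spectral.

(** * Scalar inequalities and their trace versions *)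

Lemma exprn_chebyshev (R : realFieldType) (x y : R) (q k : nat) :
  0 <= x -> 0 <= y -> 0 <= (x ^+ q - y ^+ q) * (x ^+ k - y ^+ k).
Proof.
move=> x0 y0; have [xy|/ltW yx] := leP x y.
  by rewrite mulr_le0 // subr_le0 lerXn2r.
by rewrite mulr_ge0 // subr_ge0 lerXn2r.
Qed.

(** Pair the terms [q] and [r - q]: the rearrangement inequality for [|a|] and [|b|] bounds each
    pair by [|a|^r + |b|^r], and evenness of [r] removes the absolute values. *)
Lemma sum_geom_le (R : realFieldType) (a b : R) (r : nat) : ~~ odd r ->
  \sum_(q < r.+1) a ^+ q * b ^+ (r - q) <= r.+1%:R / 2 * (a ^+ r + b ^+ r).
Proof.
move=> evr; set S := \sum_(q < _) _.
have eS : S = \sum_(q < r.+1) a ^+ (r - q) * b ^+ q.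
  rewrite /S (reindex_inj rev_ord_inj) /=; apply: eq_bigr => q _.
  by rewrite subSS subKn // -ltnS.
have key q : (q <= r)%N ->
    a ^+ q * b ^+ (r - q) + a ^+ (r - q) * b ^+ q <= a ^+ r + b ^+ r.
  move=> qr; set k := (r - q)%N.
  have absE (x : R) : x ^+ r = `|x| ^+ q * `|x| ^+ k.
    by rewrite -exprD subnKC // -normrX ger0_norm // exprn_even_ge0.
  have leabs (x y : R) i j : x ^+ i * y ^+ j <= `|x| ^+ i * `|y| ^+ j.
    by rewrite -!normrX -normrM ler_norm.
  apply: (le_trans (lerD (leabs _ _ _ _) (leabs _ _ _ _))).
  rewrite !absE -subr_ge0.
  have := exprn_chebyshev q k (normr_ge0 a) (normr_ge0 b).
  by congr (0 <= _); ring.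
suff : S + S <= r.+1%:R * (a ^+ r + b ^+ r) by lra.
rewrite {2}eS /S -big_split /=.
apply: (@le_trans _ _ (\sum_(q < r.+1) (a ^+ r + b ^+ r))).
  by apply: ler_sum => q _; apply: key; rewrite -ltnS.
by rewrite sumr_const card_ord mulr_natl.
Qed.

Lemma mxtrace_sum_geom_le (R : rcfType) (n : nat) (A B D : 'M[R]_n) (r : nat) :
  A^T = A -> B^T = B -> D^T = D -> ~~ odd r ->
  \sum_(q < r.+1) \tr (D *m A ^+ q *m D *m B ^+ (r - q))
  <= r.+1%:R / 2 * (\tr (D *m D *m A ^+ r) + \tr (D *m D *m B ^+ r)).
Proof.
move=> sA sB sD evr.
have [w [a [b [w0 _ eT]]]] := mxtrace_joint_spectral D sA sB.
rewrite sD in eT.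
(* Both traces on the right are mixed terms with one exponent zero, so the same weights resolve
   every term. *)
have -> : \tr (D *m D *m A ^+ r) = \tr (D *m A ^+ r *m D *m B ^+ 0).
  by rewrite expr0 mulmx1 -mulmxA mxtrace_mulC.
have -> : \tr (D *m D *m B ^+ r) = \tr (D *m A ^+ 0 *m D *m B ^+ r).
  by rewrite expr0 mulmx1.
rewrite !eT -big_split mulr_sumr /=.
under eq_bigr do rewrite eT.
rewrite exchange_big; apply: ler_sum => i _.
rewrite -big_split mulr_sumr exchange_big /=; apply: ler_sum => j _.
rewrite !expr0 mulr1 mul1r -mulrDr mulrCA -mulr_sumr.
by rewrite ler_wpM2l // sum_geom_le.
Qed.

(** * Sign vectors and sign flips *)

Definition flip (K : finType) (k : K) (b : {ffun K -> bool}) : {ffun K -> bool} :=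
  [ffun i => (i == k) (+) b i].

Definition rad (R : pzRingType) (K : finType) (b : {ffun K -> bool}) (k : K) : R :=
  (-1) ^+ b k.

Lemma flipK (K : finType) (k : K) : involutive (flip k).
Proof. by move=> b; apply/ffunP => i; rewrite !ffunE addbA addbb. Qed.

Lemma rad_flip (R : pzRingType) (K : finType) (b : {ffun K -> bool}) (k i : K) :
  rad R (flip k b) i = if i == k then - rad R b i else rad R b i.
Proof. by rewrite /rad ffunE; case: eqP => // _; case: (b i); rewrite ?expr1 ?opprK. Qed.

Lemma rad_sqr (R : pzRingType) (K : finType) (b : {ffun K -> bool}) (k : K) :
  rad R b k * rad R b k = 1.
Proof. by rewrite -expr2 /rad sqrr_sign. Qed.

Lemma subrXX_mx (R : pzRingType) (n : nat) (A B : 'M[R]_n) (r : nat) :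
  A ^+ r.+1 - B ^+ r.+1 = \sum_(q < r.+1) A ^+ q *m (A - B) *m B ^+ (r - q).
Proof.
elim: r => [|r IHr].
  by rewrite big_ord_recr big_ord0 /= add0r subnn !expr0 mul1mx mulmx1 !expr1.
have XS (C : 'M[R]_n) q : C ^+ q.+1 = C ^+ q *m C by apply: exprSr.
rewrite big_ord_recr /= subnn expr0 mulmx1.
have -> : \sum_(q < r.+1) A ^+ q *m (A - B) *m B ^+ (r.+1 - q)
        = (\sum_(q < r.+1) A ^+ q *m (A - B) *m B ^+ (r - q)) *m B.
  rewrite mulmx_suml; apply: eq_bigr => q _.
  by rewrite subSn ?XS ?mulmxA //; exact: (ltn_ord q).
rewrite -IHr mulmxBl mulmxBr -!XS.
by rewrite addrC addrA subrK.
Qed.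

(** * Noncommutative Khintchine inequality *)

Section Khintchine.
Variables (R : rcfType) (K : finType) (n : nat).
Variables (Y : {ffun K -> bool} -> 'M[R]_n) (D : K -> {ffun K -> bool} -> 'M[R]_n).
Hypothesis Ysym : forall b, (Y b)^T = Y b.
Hypothesis Dsym : forall k b, (D k b)^T = D k b.
Hypothesis Dflip : forall k b, D k (flip k b) = D k b.
Hypothesis YD : forall k b, Y b - Y (flip k b) = (2 * rad R b k) *: D k b.

(* Pairing [b] with [flip k b] is an integration by parts in the sign [b k]. *)
Lemma rad_mxtrace_le (k : K) (r : nat) : ~~ odd r ->
  \sum_b rad R b k * \tr (D k b *m Y b ^+ r.+1)
  <= r.+1%:R * \sum_b \tr (D k b *m D k b *m Y b ^+ r).
Proof.
move=> evr; set S := (X in X <= _).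
have flipE (F : {ffun K -> bool} -> R) : \sum_b F b = \sum_b F (flip k b).
  by apply: (reindex_inj (inv_inj (@flipK K k))).
(* Average [S] with its image under the flip: the difference of powers telescopes, and the factor
   [Y b - Y (flip k b)] supplies a second sign [rad R b k] that cancels the first. *)
have SS : S + S = 2 * \sum_b \sum_(q < r.+1)
    \tr (D k b *m Y b ^+ q *m D k b *m Y (flip k b) ^+ (r - q)).
  have eS : S = \sum_b rad R (flip k b) k
      * \tr (D k (flip k b) *m Y (flip k b) ^+ r.+1) by exact: flipE.
  rewrite {2}eS /S -big_split mulr_sumr /=; apply: eq_bigr => b _.
  rewrite rad_flip eqxx Dflip mulNr -mulrBr -raddfB /= -mulmxBr subrXX_mx.
  rewrite mulmx_sumr raddf_sum !mulr_sumr /=; apply: eq_bigr => q _.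
  rewrite YD -scalemxAr -scalemxAl -scalemxAr mxtraceZ !mulmxA mulrA.
  by rewrite mulrCA rad_sqr mulr1.
suff : S + S <= 2 * (r.+1%:R * \sum_b \tr (D k b *m D k b *m Y b ^+ r)) by lra.
rewrite SS; apply: ler_wpM2l => //.
apply: (@le_trans _ _ (\sum_b r.+1%:R / 2 * (\tr (D k b *m D k b *m Y b ^+ r)
   + \tr (D k b *m D k b *m Y (flip k b) ^+ r)))).
  by apply: ler_sum => b _; apply: mxtrace_sum_geom_le.
rewrite -mulr_sumr big_split /=.
(* [D k] does not depend on the sign [b k], so the flip carries one sum to the other. *)
have <- : \sum_b \tr (D k b *m D k b *m Y b ^+ r) =
   \sum_b \tr (D k b *m D k b *m Y (flip k b) ^+ r).
  rewrite [LHS]flipE; apply: eq_bigr => b _; by rewrite Dflip.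
by set z := \sum_b _; lra.
Qed.

(* [c] is the degree of homogeneity in Euler's identity: 1 for a Rademacher
   series, 2 for a chaos. *)
Lemma mxtrace_khintchine_step (c : R) (r : nat) : ~~ odd r ->
  (forall b, \sum_k rad R b k *: D k b = c *: Y b) ->
  c * \sum_b \tr (Y b ^+ r.+2)
  <= r.+1%:R * \sum_b \sum_k \tr (D k b *m D k b *m Y b ^+ r).
Proof.
move=> evr euler.
have -> : c * \sum_b \tr (Y b ^+ r.+2)
    = \sum_k \sum_b rad R b k * \tr (D k b *m Y b ^+ r.+1).
  rewrite [RHS]exchange_big mulr_sumr /=; apply: eq_bigr => b _.
  rewrite exprS -mxtraceZ -[_ * _ ^+ _]/(_ *m _) scalemxAl -euler mulmx_suml.
  by rewrite raddf_sum; apply: eq_bigr => k _; rewrite -scalemxAl /= mxtraceZ.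
rewrite [X in _ <= _ * X]exchange_big mulr_sumr /=.
by apply: ler_sum => k _; apply: rad_mxtrace_le.
Qed.

End Khintchine.

(** * Frobenius norm and Schur's test *)

Definition sqfrob (R : pzRingType) (m n : nat) (A : 'M[R]_(m, n)) : R :=
  \sum_i \sum_j A i j ^+ 2.

Lemma sqfrob_tr (R : pzRingType) (m n : nat) (A : 'M[R]_(m, n)) :
  sqfrob A^T = sqfrob A.
Proof.
rewrite /sqfrob exchange_big; apply: eq_bigr => i _.
by apply: eq_bigr => j _; rewrite mxE.
Qed.

Lemma mxtrace_trmul (R : pzRingType) (m n : nat) (A : 'M[R]_(m, n)) :
  \tr (A^T *m A) = sqfrob A.
Proof.
rewrite -sqfrob_tr; apply: eq_bigr => i _; rewrite mxE; apply: eq_bigr => j _.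
by rewrite !mxE expr2.
Qed.

Lemma sqfrob_ge0 (R : realDomainType) (m n : nat) (A : 'M[R]_(m, n)) :
  0 <= sqfrob A.
Proof. by apply: sumr_ge0 => i _; apply: sumr_ge0 => j _; rewrite sqr_ge0. Qed.

Lemma sqfrob_col_mx (R : pzRingType) (m1 m2 n : nat) (A : 'M[R]_(m1, n))
    (B : 'M[R]_(m2, n)) : sqfrob (col_mx A B) = sqfrob A + sqfrob B.
Proof.
rewrite /sqfrob big_split_ord /=; congr (_ + _); apply: eq_bigr => i _;
  by apply: eq_bigr => j _; rewrite (col_mxEu, col_mxEd).
Qed.

Lemma sqfrobD_le (R : realDomainType) (m n : nat) (A B : 'M[R]_(m, n)) :
  sqfrob (A + B) <= 2 * sqfrob A + 2 * sqfrob B.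
Proof.
rewrite /sqfrob !mulr_sumr -big_split /=; apply: ler_sum => i _.
rewrite !mulr_sumr -big_split /=; apply: ler_sum => j _.
rewrite !mxE -subr_ge0.
have := sqr_ge0 (A i j - B i j); congr (0 <= _); ring.
Qed.

Lemma trmxX (R : comPzRingType) (n : nat) (A : 'M[R]_n) (q : nat) :
  (A ^+ q)^T = A^T ^+ q.
Proof.
elim: q => [|q IHq]; first by rewrite !expr0 trmx1.
by rewrite exprS -[_ * _]/(_ *m _) trmx_mul IHq exprSr.
Qed.

Lemma mxtrace_mul_even (R : comPzRingType) (n : nat) (D A : 'M[R]_n) (q : nat) :
  D^T = D -> A^T = A -> \tr (D *m D *m A ^+ q.*2) = sqfrob (D *m A ^+ q).
Proof.
move=> sD sA; rewrite -mxtrace_trmul trmx_mul trmxX sA sD -addnn exprD.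
by rewrite -[_ * _]/(_ *m _) mulmxA mxtrace_mulC !mulmxA.
Qed.

Lemma mxtrace_even (R : comPzRingType) (n : nat) (A : 'M[R]_n) (q : nat) :
  A^T = A -> \tr (A ^+ q.*2) = sqfrob (A ^+ q).
Proof.
move=> sA; have := mxtrace_mul_even q (trmx1 _ _) sA.
by rewrite !mul1mx.
Qed.

Lemma weighted_cauchy (R : realFieldType) (I : finType) (a x y : I -> R) :
  (forall i, 0 <= a i) ->
  (\sum_i a i * (x i * y i)) ^+ 2
  <= (\sum_i a i * x i ^+ 2) * (\sum_i a i * y i ^+ 2).
Proof.
move=> a0; rewrite -subr_ge0.
(* Lagrange's identity: this sum of squares is twice the defect in the inequality. *)
have : 0 <= \sum_i \sum_j a i * a j * (x i * y j - x j * y i) ^+ 2.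
  by apply: sumr_ge0 => i _; apply: sumr_ge0 => j _;
    rewrite mulr_ge0 ?sqr_ge0 // mulr_ge0.
have -> : \sum_i \sum_j a i * a j * (x i * y j - x j * y i) ^+ 2
  = (\sum_i a i * x i ^+ 2) * (\sum_i a i * y i ^+ 2) 
  + (\sum_i a i * y i ^+ 2) * (\sum_i a i * x i ^+ 2) 
  - 2 * ((\sum_i a i * (x i * y i)) * (\sum_i a i * (x i * y i))).
  rewrite !big_distrlr /= mulr_sumr -big_split -sumrB /=; apply: eq_bigr => i _.
  rewrite mulr_sumr -big_split -sumrB /=; apply: eq_bigr => j _; ring.
by rewrite expr2; move: (\sum_i _) (\sum_i _) (\sum_i _) => u v w; lra.
Qed.

(** Cauchy-Schwarz with weights [a i j] against the constant 1 produces the row sums; exchanging the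
    sums then produces the column sums. *)
Lemma schur_test (R : realFieldType) (I J : finType) (a : I -> J -> R)
    (u : J -> R) (r c : R) : 0 <= r ->
  (forall i j, 0 <= a i j) -> (forall i, \sum_j a i j <= r) ->
  (forall j, \sum_i a i j <= c) ->
  \sum_i (\sum_j a i j * u j) ^+ 2 <= r * c * \sum_j u j ^+ 2.
Proof.
move=> r0 a0 ar ac.
apply: (@le_trans _ _ (\sum_i r * \sum_j a i j * u j ^+ 2)).
  apply: ler_sum => i _.
  have := @weighted_cauchy R J (a i) (fun=> 1) u (a0 i).
  under eq_bigr do rewrite mul1r.
  under [X in _ <= X * _]eq_bigr do rewrite expr1n mulr1.
  move/le_trans; apply; apply: ler_wpM2r => //.
  by apply: sumr_ge0 => j _; rewrite mulr_ge0 ?sqr_ge0.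
rewrite -mulr_sumr -mulrA; apply: ler_wpM2l => //.
rewrite exchange_big mulr_sumr /=; apply: ler_sum => j _.
by rewrite -mulr_suml ler_wpM2r ?sqr_ge0.
Qed.

(** * Khintchine inequality for rectangular series *)

Lemma mxtrace_gram_swap (R : comPzRingType) (m n : nat) (H : 'M[R]_(m, n)) p :
  \tr ((H *m H^T) ^+ p.+1) = \tr ((H^T *m H) ^+ p.+1).
Proof.
(* This intertwining lets cyclicity swap the factors. The exponent is positive because at zero the
   two traces are [m] and [n]. *)
have e q : H^T *m (H *m H^T) ^+ q = (H^T *m H) ^+ q *m H^T.
  elim: q => [|q IHq]; first by rewrite !expr0 mulmx1 mul1mx.
  by rewrite !exprSr -![_ * _]/(_ *m _) mulmxA IHq !mulmxA.
by rewrite exprS exprSr -![_ * _]/(_ *m _) -mulmxA mxtrace_mulC e mulmxA.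
Qed.

(** The self-adjoint dilation makes a rectangular series symmetric; its even powers carry both Gram
    matrices on the block diagonal. *)
Definition dilation (R : pzRingType) (m n : nat) (H : 'M[R]_(m, n)) : 'M[R]_(m + n) :=
  block_mx 0 H H^T 0.

Lemma dilation_sym (R : pzRingType) (m n : nat) (H : 'M[R]_(m, n)) :
  (dilation H)^T = dilation H.
Proof. by rewrite /dilation tr_block_mx !trmx0 trmxK. Qed.

Lemma dilation_even (R : pzRingType) (m n : nat) (H : 'M[R]_(m, n)) (p : nat) :
  dilation H ^+ p.*2 = block_mx ((H *m H^T) ^+ p) 0 0 ((H^T *m H) ^+ p).
Proof.
elim: p => [|p IHp]; first by rewrite !expr0 -[1]/(1%:M) scalar_mx_block.
rewrite doubleS !exprSr IHp -![_ * _]/(_ *m _) -mulmxA /dilation !mulmx_block.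
by rewrite !(mul0mx, mulmx0, addr0, add0r).
Qed.

Lemma mxtrace_dilation (R : comPzRingType) (m n : nat) (H : 'M[R]_(m, n)) (p : nat) :
  \tr (dilation H ^+ p.+1.*2) = 2 * \tr ((H^T *m H) ^+ p.+1).
Proof.
by rewrite dilation_even mxtrace_block mxtrace_gram_swap mulr_natl mulr2n.
Qed.

(** Bernoulli's inequality for [(1 + 1/q)^k] at [q = p + 1], [k = p + 2], with denominators cleared.
    It absorbs the factor [2p + 3] of each moment step into the growth of [p^p]. *)
Lemma succ_expn_succ_ge (p : nat) :
  (p.*2.+3 * p.+1 ^ p.+1 <= p.+2 ^ p.+2)%N.
Proof.
have bernoulli q k : (q ^ k * (q + k) <= q.+1 ^ k * q)%N.
  elim: k => [|k IHk]; first by rewrite !expn0 addn0.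
  rewrite !expnS; move: (q ^ k)%N (q.+1 ^ k)%N IHk => u v; nia.
have := bernoulli p.+1 p.+2; rewrite [(p.+1 ^ p.+2)%N]expnSr mulnAC leq_pmul2r //.
by rewrite mulnC; congr (_ * _ <= _)%N; rewrite -addnn; lia.
Qed.

Section RectangularKhintchine.
Variables (R : rcfType) (K : finType) (m n : nat) (C : K -> 'M[R]_(m, n)).
Let H b := \sum_l rad R b l *: C l.
Variable sigma : R.
Hypothesis sigma_ge0 : 0 <= sigma.
Hypothesis Cleft : forall q (V : 'M[R]_(n, q)),
  \sum_l sqfrob (C l *m V) <= sigma * sqfrob V.
Hypothesis Cright : forall q (U : 'M[R]_(m, q)),
  \sum_l sqfrob ((C l)^T *m U) <= sigma * sqfrob U.

(** The symmetric step for the dilated series, which has degree 1 and constant derivatives. [Cleft]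
    and [Cright] bound the two variance sums by [sigma]. *)
Lemma mxtrace_gram_step (p : nat) :
  \sum_b \tr (((H b)^T *m H b) ^+ p.+2)
  <= (p.*2.+3)%:R * sigma * \sum_b \tr (((H b)^T *m H b) ^+ p.+1).
Proof.
pose Y b := dilation (H b); pose E (k : K) (b : {ffun K -> bool}) := dilation (C k).
have dilD (A B : 'M[R]_(m, n)) : dilation (A + B) = dilation A + dilation B.
  by rewrite /dilation add_block_mx linearD /= !addr0.
have dilZ a (A : 'M[R]_(m, n)) : dilation (a *: A) = a *: dilation A.
  by rewrite /dilation scale_block_mx linearZ /= !scaler0.
have dil0 : dilation (0 : 'M[R]_(m, n)) = 0.
  by rewrite /dilation trmx0 block_mx0.
have euler b : \sum_k rad R b k *: E k b = 1 *: Y b.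
  rewrite scale1r /Y /H (big_morph _ dilD dil0).
  by apply: eq_bigr => k _; rewrite dilZ.
have YE k b : Y b - Y (flip k b) = (2 * rad R b k) *: E k b.
  have := euler b; have := euler (flip k b); rewrite !scale1r => <- <-.
  rewrite -sumrB (bigD1 k) //= big1 => [|i /negbTE ik].
    by rewrite rad_flip eqxx addr0 scaleNr opprK -scalerDl mulr_natl mulr2n.
  by rewrite rad_flip ik subrr.
have := @mxtrace_khintchine_step R K _ Y E (fun b => dilation_sym _)
  (fun k b => dilation_sym _) (fun _ _ => erefl) YE 1 p.+1.*2.
rewrite odd_double => /(_ isT euler).
rewrite -doubleS /Y mul1r => le1.
have le2 : \sum_b \sum_k \tr (E k b *m E k b *m dilation (H b) ^+ p.+1.*2)
   <= sigma * \sum_b \tr (dilation (H b) ^+ p.+1.*2).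
  rewrite mulr_sumr; apply: ler_sum => b _.
  rewrite mxtrace_even ?dilation_sym //.
  under eq_bigr do rewrite mxtrace_mul_even ?dilation_sym //.
  (* Splitting the power into row blocks [U] and [V], the dilated coefficient sends them to
     [C k *m V] and [(C k)^T *m U], one for each variance bound. *)
  rewrite -[_ ^+ _]vsubmxK; set U := usubmx _; set V := dsubmx _.
  under eq_bigr => k _ do
    rewrite /E /dilation mul_block_col !mul0mx add0r addr0 sqfrob_col_mx.
  by rewrite big_split sqfrob_col_mx mulrDr addrC lerD.
have := le_trans le1 (ler_wpM2l (ler0n _ _) le2).
under eq_bigr do rewrite mxtrace_dilation.
under [X in _ <= _ * (_ * X)]eq_bigr do rewrite mxtrace_dilation.
rewrite -!mulr_sumr doubleS; move: (\sum_b _) (\sum_b _) => u v; lra.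
Qed.

Lemma mxtrace_gram_moment (c : R) (p : nat) : 0 <= c ->
  \sum_b \tr ((H b)^T *m H b) <= c * sigma ->
  \sum_b \tr (((H b)^T *m H b) ^+ p.+1) <= c * (p.+1%:R * sigma) ^+ p.+1.
Proof.
move=> c0 base; elim: p => [|p IHp].
  by under eq_bigr do rewrite expr1; rewrite expr1 mul1r.
apply: (le_trans (mxtrace_gram_step p)).
apply: (le_trans (ler_wpM2l _ IHp)); first by rewrite mulr_ge0.
rewrite !exprMn [X in _ <= _ * (_ * X)]exprS.
have -> : p.*2.+3%:R * sigma * (c * (p.+1%:R ^+ p.+1 * sigma ^+ p.+1))
  = c * sigma * sigma ^+ p.+1 * (p.*2.+3%:R * p.+1%:R ^+ p.+1) by ring.
have -> : c * (p.+2%:R ^+ p.+2 * (sigma * sigma ^+ p.+1))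
  = c * sigma * sigma ^+ p.+1 * (p.+2%:R ^+ p.+2) by ring.
apply: ler_wpM2l; first by rewrite !mulr_ge0 ?exprn_ge0.
rewrite -!natrX -natrM ler_nat.
exact: succ_expn_succ_ge.
Qed.

End RectangularKhintchine.

Lemma sum_indic (R : pzRingType) (I : finType) (a : I) (F : I -> R) :
  \sum_i (a == i)%:R * F i = F a.
Proof.
rewrite (bigD1 a) //= eqxx mul1r big1 ?addr0 // => i.
by rewrite eq_sym => /negbTE ->; rewrite mul0r.
Qed.

Lemma sum_indic1 (R : pzRingType) (I : finType) (a : I) :
  \sum_i (a == i)%:R = 1 :> R.
Proof.
transitivity (\sum_i (a == i)%:R * (fun=> 1 : R) i); last exact: sum_indic.
by apply: eq_bigr => i _; rewrite mulr1.
Qed.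

Lemma sum_indic_inj_le1 (R : realDomainType) (I : finType) (K : eqType) (f : I -> K) k :
  injective f -> \sum_i (f i == k)%:R <= 1 :> R.
Proof.
move=> injf; have [/existsP[i /eqP fi]|/existsPn nk] := boolP [exists i, f i == k].
  rewrite (bigD1 i) //= fi eqxx big1 ?addr0 // => i' /negbTE ni.
  by rewrite -fi (inj_eq injf) ni.
by rewrite big1 ?ler01 // => i _; rewrite (negbTE (nk i)).
Qed.

(** * Off-diagonal Gram matrix of a sign pattern *)

Section Pattern.
Variables (R : rcfType) (K : finType) (n s : nat) (kappa : 'I_n -> 'I_s -> K).
Hypothesis kappa_injl : forall j, injective (kappa^~ j).
Hypothesis kappa_injr : forall i, injective (kappa i).
Implicit Types (b : {ffun K -> bool}).

(** This is the chaos [X], that is, [n] times the off-diagonal part of the normalized Gram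
    matrix. *)
Definition gram_off b : 'M[R]_s :=
  \matrix_(j, j') ((j != j')%:R * \sum_i rad R b (kappa i j) * rad R b (kappa i j')).

(* The derivative of [gram_off] in the sign [b k] is [half_diff k b] plus its
   transpose. *)
Definition half_diff (k : K) b : 'M[R]_s :=
  \matrix_(j, j') ((j != j')%:R * \sum_i (kappa i j' == k)%:R * rad R b (kappa i j)).

(* [half_stack] is the vertical stack of all the [half_diff k b]; the row
   indexed by [x] is row [(enum_val x).2] of block [(enum_val x).1]. *)
Definition stack_coef (l : K) : 'M[R]_(#|{: K * 'I_s}|, s) :=
  \matrix_(x, j') (((enum_val x).2 != j')%:R *
    \sum_i (kappa i j' == (enum_val x).1)%:R * (kappa i (enum_val x).2 == l)%:R).

Definition half_stack b := \sum_l rad R b l *: stack_coef l.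

Lemma gram_off_sym b : (gram_off b)^T = gram_off b.
Proof.
apply/matrixP => j j'; rewrite !mxE eq_sym; congr (_ * _).
by apply: eq_bigr => i _; rewrite mulrC.
Qed.

Lemma half_stackE b x j' :
  half_stack b x j' = half_diff (enum_val x).1 b (enum_val x).2 j'.
Proof.
rewrite summxE mxE; under eq_bigr do rewrite mxE mxE mulrCA mulr_sumr.
rewrite -mulr_sumr exchange_big /=; congr (_ * _); apply: eq_bigr => i _.
under eq_bigr do rewrite mulrCA mulrC.
rewrite -mulr_suml mulrC; congr (_ * _).
by rewrite -[RHS]sum_indic; apply: eq_bigr => l _; rewrite mulrC.
Qed.

Lemma sum_stack (F : K -> 'I_s -> R) :
  \sum_(x < #|{: K * 'I_s}|) F (enum_val x).1 (enum_val x).2 = \sum_k \sum_j F k j.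
Proof.
rewrite pair_big /= [RHS](reindex (fun x : 'I_#|{: K * 'I_s}| => enum_val x)) //=.
by apply: onW_bij; apply: enum_val_bij.
Qed.

(** Stacking turns the sum of the [H_k^T H_k] into a single Gram matrix of a series linear in the
    signs, to which the rectangular bound applies. *)
Lemma half_stack_gram b :
  (half_stack b)^T *m half_stack b = \sum_k (half_diff k b)^T *m half_diff k b.
Proof.
apply/matrixP => j j'; rewrite !mxE summxE.
under eq_bigr do rewrite mxE !half_stackE.
rewrite (sum_stack (fun k l => half_diff k b l j * half_diff k b l j')).
by apply: eq_bigr => k _; rewrite mxE; apply: eq_bigr => l _; rewrite !mxE.
Qed.

Lemma sum_half_diff b : \sum_k rad R b k *: half_diff k b = gram_off b.
Proof.
apply/matrixP => j j'; rewrite summxE mxE.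
under eq_bigr do rewrite mxE mxE mulrCA mulr_sumr.
rewrite -mulr_sumr exchange_big /=; congr (_ * _); apply: eq_bigr => i _.
under eq_bigr do rewrite mulrCA.
by rewrite (sum_indic _ (fun k => rad R b k * _)) mulrC.
Qed.

(** Where [kappa i j' = k] and [j != j'], row injectivity gives [kappa i j != k], so the sign [b k]
    never occurs. *)
Lemma half_diff_flip k b : half_diff k (flip k b) = half_diff k b.
Proof.
apply/matrixP => j j'; rewrite !mxE; have [//|jj'] := eqVneq j j'.
  by rewrite !mul0r.
congr (_ * _); apply: eq_bigr => i _; case: eqP => [<-|_]; last by rewrite !mul0r.
by rewrite rad_flip (inj_eq (@kappa_injr i)) (negbTE jj').
Qed.

Lemma gram_off_flip k b : gram_off b - gram_off (flip k b)
  = (2 * rad R b k) *: (half_diff k b + (half_diff k b)^T).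
Proof.
apply/matrixP => j j'; rewrite !mxE [in j' != j]eq_sym -mulrDr -mulrBr.
have [_|jj'] := eqVneq j j'; first by rewrite !mul0r mulr0.
rewrite !mul1r -sumrB -big_split mulr_sumr /=; apply: eq_bigr => i _.
(* At most one factor of each product changes sign, so the chaos is affine in [b k]. *)
have njj' : kappa i j != kappa i j' by rewrite (inj_eq (@kappa_injr i)).
rewrite !rad_flip.
have [e1|n1] := eqVneq (kappa i j) k; have [e2|n2] := eqVneq (kappa i j') k.
- by rewrite e1 e2 eqxx in njj'.
- by rewrite e1 /=; ring.
- by rewrite e2 /=; ring.
- by rewrite /=; ring.
Qed.

(** Summing over [k] forces [kappa i j' = kappa i' j'], hence [i = i'] by column injectivity. What
    remains counts the [j'] different from [j] and [j1]: [s - 1] on the diagonal, [s - 2] off it. *)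
Lemma sum_half_diff_mul_tr b :
  \sum_k half_diff k b *m (half_diff k b)^T
  = (n%:R * (s%:R - 1)) *: 1%:M + (s%:R - 2) *: gram_off b.
Proof.
apply/matrixP => j j1; rewrite summxE.
have e : \sum_k (half_diff k b *m (half_diff k b)^T) j j1
  = (\sum_j' (j != j')%:R * (j1 != j')%:R)
    * \sum_i rad R b (kappa i j) * rad R b (kappa i j1).
  under eq_bigr do rewrite mxE; rewrite exchange_big mulr_suml /=.
  apply: eq_bigr => j' _; under eq_bigr do rewrite !mxE mulrACA.
  rewrite -mulr_sumr; congr (_ * _).
  under [LHS]eq_bigr do rewrite mulr_suml.
  rewrite exchange_big /=; apply: eq_bigr => i _.
  under eq_bigr do rewrite -mulrA.
  rewrite sum_indic; congr (_ * _).
  rewrite (bigD1 i) //= eqxx mul1r big1 ?addr0 // => i' ni.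
  by rewrite (inj_eq (@kappa_injl j')) (negbTE ni) mul0r.
rewrite e !mxE; have [<-|jj1] := eqVneq j j1.
  rewrite mul0r !mulr0 addr0 mulr1; under [X in _ * X]eq_bigr do rewrite rad_sqr.
  rewrite sumr_const card_ord mulrC; congr (_ * _).
  transitivity (\sum_(j' < s) (1 - (j == j')%:R : R)).
    apply: eq_bigr => j' _.
    by case: eqP; rewrite /= ?mul0r ?mul1r ?subrr ?subr0.
  by rewrite sumrB sum_indic1 sumr_const card_ord.
rewrite mul1r mulr0 add0r; congr (_ * _).
transitivity (\sum_(j' < s) (1 - (j == j')%:R - (j1 == j')%:R : R)).
  apply: eq_bigr => j' _; have [<-|_] := eqVneq j j'.
    by rewrite eq_sym (negbTE jj1) mul0r subrr subr0.
  by case: eqP; rewrite /= ?mulr0 ?mulr1 ?subr0 ?subrr.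
by rewrite !sumrB !sum_indic1 sumr_const card_ord -addrA -opprD.
Qed.

(** Cyclicity replaces [H_k^T H_k] by [H_k H_k^T]; since [X] has zero diagonal, the trace is the
    same for every [b]. *)
Lemma mxtrace_half_stack b :
  \tr ((half_stack b)^T *m half_stack b) = s%:R * (n%:R * (s%:R - 1)).
Proof.
rewrite half_stack_gram raddf_sum /=.
under eq_bigr do rewrite mxtrace_mulC.
rewrite -raddf_sum /= sum_half_diff_mul_tr // raddfD /= !mxtraceZ mxtrace1.
rewrite [\tr (gram_off b)]big1 => [|j _]; last by rewrite mxE eqxx mul0r.
by rewrite mulr0 addr0 mulrC.
Qed.

(** The entry of [stack_coef l] in row [(k, j)] and column [j']. It is nonnegative, so Schur's test
    needs only the row and column sums below. *)
Let inc k l j j' : R := (j != j')%:R *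
  \sum_i (kappa i j' == k)%:R * (kappa i j == l)%:R.

Lemma inc_ge0 k l j j' : 0 <= inc k l j j'.
Proof. by rewrite mulr_ge0 // sumr_ge0 // => i _; rewrite mulr_ge0. Qed.

Lemma inc_le k l j j' :
  inc k l j j' <= \sum_i (kappa i j' == k)%:R * (kappa i j == l)%:R.
Proof.
apply: ler_piMl; last by rewrite lern1 leq_b1.
by rewrite sumr_ge0 // => i _; rewrite mulr_ge0.
Qed.

(** [kappa i j = l] determines [i], and then [kappa i j' = k] determines [j']. *)
Lemma sum_inc_j' l k j : \sum_j' inc k l j j' <= 1.
Proof.
apply: (le_trans (ler_sum _ (fun j' _ => inc_le k l j j'))).
rewrite exchange_big /=.
apply: le_trans (sum_indic_inj_le1 R l (@kappa_injl j)); apply: ler_sum => i _.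
by rewrite -mulr_suml ler_piMl // sum_indic_inj_le1.
Qed.

(** For fixed [j'], each of the [n s] pairs [(i, j)] determines [k] and [l]. *)
Lemma sum_inc_lkj j' : \sum_l \sum_k \sum_j inc k l j j' <= (n * s)%:R.
Proof.
under eq_bigr do rewrite exchange_big.
rewrite exchange_big /= mulnC natrM mulr_natl -[X in _ *+ X](card_ord s) -sumr_const.
apply: ler_sum => j _.
apply: (@le_trans _ _ (\sum_l \sum_k \sum_i
   (kappa i j' == k)%:R * (kappa i j == l)%:R)).
  by apply: ler_sum => l _; apply: ler_sum => k _; exact: inc_le.
under eq_bigr => l _.
  rewrite exchange_big /=; under eq_bigr do rewrite -mulr_suml sum_indic1 mul1r.
  over.
rewrite exchange_big /=; under eq_bigr do rewrite sum_indic1.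
by rewrite sumr_const card_ord.
Qed.

Lemma sum_inc_kj l j' : \sum_k \sum_j inc k l j j' <= s%:R.
Proof.
rewrite exchange_big /= -[X in _ <= X%:R](card_ord s) -sumr_const.
apply: ler_sum => j _.
apply: (le_trans (ler_sum _ (fun k _ => inc_le k l j j'))).
apply: le_trans (sum_indic_inj_le1 R l (@kappa_injl j)).
by rewrite exchange_big /=; apply: ler_sum => i _; rewrite -mulr_suml sum_indic1 mul1r.
Qed.

Lemma sum_inc_lj' k j : \sum_l \sum_j' inc k l j j' <= s%:R.
Proof.
rewrite exchange_big /= -[X in _ <= X%:R](card_ord s) -sumr_const.
apply: ler_sum => j' _.
apply: (le_trans (ler_sum _ (fun l _ => inc_le k l j j'))).
apply: le_trans (sum_indic_inj_le1 R k (@kappa_injl j')).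
by rewrite exchange_big /=; apply: ler_sum => i _; rewrite -mulr_sumr sum_indic1 mulr1.
Qed.

(** Schur's test with rows [(l, (k, j))] and columns [j']: row sums at most 1, column sums at most
    [n s]. *)
Lemma stack_coef_left q (V : 'M[R]_(s, q)) :
  \sum_l sqfrob (stack_coef l *m V) <= (n * s)%:R * sqfrob V.
Proof.
rewrite /sqfrob pair_big /= exchange_big [X in _ <= _ * X]exchange_big /= mulr_sumr.
apply: ler_sum => c _.
pose a (y : K * 'I_#|{: K * 'I_s}|) j' :=
  inc (enum_val y.2).1 y.1 (enum_val y.2).2 j'.
have h : \sum_y (\sum_j' a y j' * V j' c) ^+ 2
    <= 1 * (n * s)%:R * \sum_j' V j' c ^+ 2; last first.
  move: h; rewrite mul1r; congr (_ <= _); apply: eq_bigr => -[l x] _.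
  by rewrite mxE; under [in RHS]eq_bigr do rewrite mxE.
apply: schur_test => //.
- by move=> *; exact: inc_ge0.
- by move=> ?; exact: sum_inc_j'.
- move=> j'; rewrite -(pair_bigA _ (fun l x => a (l, x) j')) /=.
  apply: le_trans (sum_inc_lkj j'); apply: ler_sum => l _.
  by rewrite (sum_stack (fun k j => inc k l j j')).
Qed.

(** Schur's test with rows [(l, j')] and columns [(k, j)]: both kinds of sums are at most [s]. *)
Lemma stack_coef_right q (U : 'M[R]_(#|{: K * 'I_s}|, q)) :
  \sum_l sqfrob ((stack_coef l)^T *m U) <= (s * s)%:R * sqfrob U.
Proof.
rewrite /sqfrob pair_big /= exchange_big [X in _ <= _ * X]exchange_big /= mulr_sumr.
apply: ler_sum => c _.
pose a (y : K * 'I_s) (x : 'I_#|{: K * 'I_s}|) :=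
  inc (enum_val x).1 y.1 (enum_val x).2 y.2.
have h : \sum_y (\sum_x a y x * U x c) ^+ 2
    <= s%:R * s%:R * \sum_x U x c ^+ 2; last first.
  move: h; rewrite natrM; congr (_ <= _); apply: eq_bigr => -[l j'] _.
  by rewrite mxE; under [in RHS]eq_bigr do rewrite 2!mxE.
apply: schur_test => //.
- by move=> *; exact: inc_ge0.
- move=> [l j']; rewrite (sum_stack (fun k j => inc k l j j')).
  exact: sum_inc_kj.
- move=> x; rewrite -(pair_bigA _ (fun l j' => a (l, j') x)) /=.
  exact: sum_inc_lj'.
Qed.

(** The rectangular bound with [sigma = n s]; the assumption [s <= n] brings the right variance
    [s^2] below it. *)
Lemma half_stack_moment p : (s <= n)%N ->
  \sum_b \tr (((half_stack b)^T *m half_stack b) ^+ p.+1)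
  <= #|{: {ffun K -> bool}}|%:R * s%:R * (p.+1%:R * (n * s)%:R) ^+ p.+1.
Proof.
move=> sn; apply: mxtrace_gram_moment.
- exact: ler0n.
- exact: stack_coef_left.
- move=> q U; apply: (le_trans (stack_coef_right U)); apply: ler_wpM2r.
    exact: sqfrob_ge0.
  by rewrite ler_nat leq_mul2r sn orbT.
- by rewrite mulr_ge0.
under eq_bigr do rewrite mxtrace_half_stack //.
rewrite sumr_const -[leLHS]mulr_natl -[leRHS]mulrA.
apply: ler_wpM2l; first exact: ler0n.
apply: ler_wpM2l => //.
by rewrite natrM; apply: ler_wpM2l => //; rewrite lerBlDr lerDl.
Qed.

End Pattern.

(** * Moment bound for the chaos *)

Lemma young_exprn (R : realFieldType) (u v : R) (q : nat) : 0 <= u -> 0 <= v ->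
  q.+1%:R * (u * v ^+ q) <= u ^+ q.+1 + q%:R * v ^+ q.+1.
Proof.
move=> u0 v0; elim: q => [|q IHq]; first by rewrite !expr0 !expr1; lra.
(* Add this inequality to [v] times the induction hypothesis. *)
have := exprn_chebyshev 1 q.+1 u0 v0; rewrite !expr1 => ch.
have := ler_wpM2l v0 IHq.
rewrite ![_ ^+ q.+2]exprS -![_.+2%:R]natr1 -![_.+1%:R]natr1.
move: ch; rewrite ![_ ^+ q.+1]exprS.
move: (u ^+ q) (v ^+ q) (q%:R : R) => U V Q; lra.
Qed.

Section PatternMoment.
Variables (R : rcfType) (K : finType) (n s : nat) (kappa : 'I_n -> 'I_s -> K).
Hypothesis kappa_injl : forall j, injective (kappa^~ j).
Hypothesis kappa_injr : forall i, injective (kappa i).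
Local Notation X := (gram_off R kappa).
Local Notation W b := ((half_stack R kappa b)^T *m half_stack R kappa b).

(** The Khintchine step in degree 2 for [D_k = H_k + H_k^T]. Bounding the square of the sum by twice
    the sum of squares costs a factor 2, which cancels the degree. *)
Lemma gram_off_moment_step q :
  \sum_b \tr (X b ^+ q.+1.*2)
  <= q.*2.+1%:R * \sum_b (\tr (X b ^+ q.*2 *m W b)
     + n%:R * (s%:R - 1) * \tr (X b ^+ q.*2)
     + (s%:R - 2) * \tr (X b ^+ q.*2.+1)).
Proof.
pose D k b := half_diff R kappa k b + (half_diff R kappa k b)^T.
have Dsym k b : (D k b)^T = D k b by rewrite /D linearD /= trmxK addrC.
have := @mxtrace_khintchine_step R K s X D (gram_off_sym _ _) Dsym _
  (gram_off_flip _ kappa_injr) 2 q.*2.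
rewrite odd_double => /(_ _ isT) h.
have {h} le1 := h _ _.
have {le1} : 2 * \sum_b \tr (X b ^+ q.+1.*2)
   <= q.*2.+1%:R * \sum_b \sum_k \tr (D k b *m D k b *m X b ^+ q.*2).
  apply: le1 => [k b|b]; first by rewrite /D half_diff_flip.
  under eq_bigr do rewrite scalerDr.
  rewrite big_split /= sum_half_diff.
  under eq_bigr do rewrite -linearZ /=.
  by rewrite -linear_sum /= sum_half_diff gram_off_sym scaler_nat mulr2n.
have le2 : \sum_b \sum_k \tr (D k b *m D k b *m X b ^+ q.*2) <=
   \sum_b 2 * (\tr (X b ^+ q.*2 *m W b)
     + n%:R * (s%:R - 1) * \tr (X b ^+ q.*2)
     + (s%:R - 2) * \tr (X b ^+ q.*2.+1)).
  apply: ler_sum => b _; set Z := X b ^+ q.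
  have Zsym : Z^T = Z by rewrite trmxX gram_off_sym.
  have ZZ : X b ^+ q.*2 = Z *m Z by rewrite -addnn exprD.
  have sqL m (A : 'M[R]_(m, s)) : sqfrob (A *m Z) = \tr (X b ^+ q.*2 *m (A^T *m A)).
    rewrite -mxtrace_trmul trmx_mul Zsym ZZ mxtrace_mulC !mulmxA.
    by rewrite [RHS]mxtrace_mulC !mulmxA.
  apply: (@le_trans _ _ (\sum_k (2 * sqfrob (half_diff R kappa k b *m Z)
      + 2 * sqfrob ((half_diff R kappa k b)^T *m Z)))).
    apply: ler_sum => k _; rewrite mxtrace_mul_even ?gram_off_sym // -/Z mulmxDl.
    exact: sqfrobD_le.
  rewrite big_split /= -!mulr_sumr -addrA [leRHS]mulrDr.
  under eq_bigr do rewrite sqL.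
  under [X in 2 * _ + 2 * X]eq_bigr do rewrite sqL trmxK.
  have trsum (F : K -> 'M[R]_s) :
      \sum_k \tr (X b ^+ q.*2 *m F k) = \tr (X b ^+ q.*2 *m \sum_k F k).
    by rewrite mulmx_sumr raddf_sum.
  rewrite !trsum -half_stack_gram sum_half_diff_mul_tr //.
  rewrite mulmxDr -!scalemxAr mulmx1 raddfD /= !mxtraceZ.
  by rewrite -[_ *m gram_off _ _ _]exprSr.
move=> /le_trans /(_ (ler_wpM2l (ler0n _ _) le2)).
rewrite -mulr_sumr mulrCA ler_pM2l //.
Qed.

(** The scalar form of the moment recursion, with [x] and [omega] in the roles of eigenvalues of [X]
    and of the stack's Gram matrix. Young's inequality pairs [x^2] with [4 p omega] and with
    [4 p^2 n s], the target scale. *)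
Lemma spectral_young (q : nat) (omega x : R) : (1 < s)%N -> (64 * s <= n)%N ->
  let p := q.+1%:R : R in let Nn := (n * s)%:R : R in 0 <= omega ->
  64 * p ^+ 3 * (x ^+ q.*2 * omega + n%:R * (s%:R - 1) * x ^+ q.*2
     + (s%:R - 2) * x ^+ q.*2.+1)
  <= 16 * p * ((4 * p * omega) ^+ q.+1 + q%:R * x ^+ q.+1.*2)
     + (16 + p) * ((4 * p ^+ 2 * Nn) ^+ q.+1 + q%:R * x ^+ q.+1.*2)
     + 4 * p ^+ 2 * x ^+ q.+1.*2.
Proof.
move=> s1 sn p Nn om0.
have p1 : 1 <= p by rewrite /p ler1n.
have s2 : 2 <= s%:R :> R by rewrite ler_nat.
have sn' : 64 * s%:R <= n%:R :> R by rewrite -natrM ler_nat.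
have NnE : Nn = n%:R * s%:R by rewrite /Nn natrM.
have Nn0 : 0 <= Nn by exact: ler0n.
have evX k : x ^+ k.*2 = (x ^+ 2) ^+ k by rewrite -exprM mul2n.
have y1 := young_exprn q (mulr_ge0 (mulr_ge0 (ler0n R 4) (le_trans ler01 p1)) om0)
  (sqr_ge0 x).
have b0 : 0 <= 4 * p ^+ 2 * Nn by rewrite !mulr_ge0 ?exprn_ge0 // (le_trans ler01 p1).
have y2 := young_exprn q b0 (sqr_ge0 x).
have t0 : 0 <= x ^+ q.*2 by rewrite evX exprn_ge0 ?sqr_ge0.
rewrite -!evX -/p in y1 y2.
have x2 : x ^+ q.+1.*2 = x ^+ q.*2 * x ^+ 2 by rewrite doubleS !exprSr expr0 mul1r mulrA.
rewrite [x ^+ q.*2.+1]exprSr.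
have y3 : n%:R * (s%:R - 1) * x ^+ q.*2 <= Nn * x ^+ q.*2.
  by rewrite ler_wpM2r // NnE ler_wpM2l //; lra.
(* The odd power of [x] is removed by completing a square; [64 s <= n] makes [64 (s - 2)^2] at most
   [n s]. *)
have y4 : 16 * p * ((s%:R - 2) * x) <= p ^+ 2 * Nn + x ^+ 2.
  have h1 := sqr_ge0 (8 * p * (s%:R - 2) - x).
  have h2 : 64 * (s%:R - 2) ^+ 2 <= Nn.
    by rewrite NnE; apply: le_trans (ler_wpM2r (ler0n _ s) sn'); nra.
  have h3 := ler_wpM2l (sqr_ge0 p) h2; lra.
have y5 : (4 * p ^+ 2) * (x ^+ q.*2 * (16 * p * ((s%:R - 2) * x)))
   <= (4 * p ^+ 2) * (x ^+ q.*2 * (p ^+ 2 * Nn + x ^+ 2)).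
  by do 2 (rewrite ler_wpM2l // ?mulr_ge0 ?sqr_ge0 //).
have y3' := ler_wpM2l (exprn_ge0 3 (le_trans ler01 p1)) y3.
have y1' := ler_wpM2l (le_trans ler01 p1) y1.
have y2' := ler_wpM2l (le_trans ler01 p1) y2.
move: y1' y2 y2' y3' y5; rewrite x2.
move: ((4 * p * omega) ^+ q.+1) ((4 * p ^+ 2 * Nn) ^+ q.+1) (x ^+ q.*2) => U V t.
move: (q%:R : R) => Q; lra.
Qed.

Lemma gram_off_moment (q : nat) : (1 < s)%N -> (64 * s <= n)%N ->
  \sum_b \tr (X b ^+ q.+1.*2)
  <= #|{: {ffun K -> bool}}|%:R * s%:R * (4 * q.+1%:R ^+ 2 * (n * s)%:R) ^+ q.+1.
Proof.
move=> s1 sn; set G := (X in X <= _); set B := (X in _ <= X).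
pose p : R := q.+1%:R.
have p1 : 1 <= p by rewrite /p ler1n.
pose T : R := \sum_b \tr (W b ^+ q.+1).
have leT : (4 * p) ^+ q.+1 * T <= B.
  have sn' : (s <= n)%N by rewrite (leq_trans _ sn) // leq_pmull.
  have h := half_stack_moment R kappa_injl kappa_injr q sn'.
  apply: (le_trans (ler_wpM2l _ h)).
    by rewrite exprn_ge0 // mulr_ge0 // (le_trans ler01 p1).
  rewrite /B mulrCA -exprMn le_eqVlt; apply/orP; left; apply/eqP.
  by congr (_ * _ ^+ _); rewrite /p; ring.
have key b : 64 * p ^+ 3 * (\tr (X b ^+ q.*2 *m W b)
     + n%:R * (s%:R - 1) * \tr (X b ^+ q.*2)
     + (s%:R - 2) * \tr (X b ^+ q.*2.+1))
  <= 16 * p * ((4 * p) ^+ q.+1 * \tr (W b ^+ q.+1) + q%:R * \tr (X b ^+ q.+1.*2))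
     + (16 + p) * (s%:R * (4 * p ^+ 2 * (n * s)%:R) ^+ q.+1
         + q%:R * \tr (X b ^+ q.+1.*2))
     + 4 * p ^+ 2 * \tr (X b ^+ q.+1.*2).
  have Wsym : (W b)^T = W b by rewrite trmx_mul trmxK.
  (* Resolving with [H = 1] reduces the claim to [spectral_young] at each pair of eigenvalues. The
     weights sum to [s], which is how constants acquire the factor [s]. *)
  have [w [x [om [w0 om0 eT]]]] :=
    mxtrace_joint_spectral 1%:M (gram_off_sym R kappa b) Wsym.
  have {}om0 := om0 _ _ erefl.
  have eT' a c : \tr (X b ^+ a *m W b ^+ c)
     = \sum_i \sum_j w i j * (x j ^+ a * om i ^+ c).
    by rewrite -eT trmx1 mul1mx mulmx1.
  pose S (F : 'I_s -> 'I_s -> R) := \sum_i \sum_j w i j * F i j.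
  have SZ c F : c * S F = S (fun i j => c * F i j).
    rewrite /S mulr_sumr; apply: eq_bigr => i _; rewrite mulr_sumr.
    by apply: eq_bigr => j _; rewrite mulrCA.
  have SD F F' : S F + S F' = S (fun i j => F i j + F' i j).
    rewrite /S -big_split; apply: eq_bigr => i _; rewrite -big_split /=.
    by apply: eq_bigr => j _; rewrite mulrDr.
  have eX a : \tr (X b ^+ a) = S (fun i j => x j ^+ a).
    have := eT' a 0; rewrite expr0 mulmx1 => ->.
    by apply: eq_bigr => i _; apply: eq_bigr => j _; rewrite expr0 mulr1.
  have eW a : \tr (W b ^+ a) = S (fun i j => om i ^+ a).
    have := eT' 0 a; rewrite expr0 mul1mx => ->.
    by apply: eq_bigr => i _; apply: eq_bigr => j _; rewrite expr0 mul1r.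
  have eXW : \tr (X b ^+ q.*2 *m W b) = S (fun i j => x j ^+ q.*2 * om i).
    have := eT' q.*2 1%N; rewrite expr1 => ->.
    by apply: eq_bigr => i _; apply: eq_bigr => j _; rewrite expr1.
  have e1 c : s%:R * c = S (fun i j => c).
    have := eX 0%N; rewrite expr0 mxtrace1 mulrC => ->; rewrite SZ.
    by apply: eq_bigr => i _; apply: eq_bigr => j _; rewrite expr0 mulr1.
  rewrite eXW !eX eW e1 !(SZ, SD).
  apply: ler_sum => i _; apply: ler_sum => j _; apply: ler_wpM2l => //.
  have := spectral_young q (x j) s1 sn (om0 i).
  by rewrite exprMn.
have step := gram_off_moment_step q; rewrite -/G in step.
set V := (X in _ * X) in step.
have le1 : 64 * p ^+ 3 * V <= 16 * p * ((4 * p) ^+ q.+1 * T + q%:R * G)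
    + (16 + p) * (B + q%:R * G) + 4 * p ^+ 2 * G.
  rewrite /V mulr_sumr.
  apply: (le_trans (ler_sum _ (fun b _ => key b))).
  rewrite !big_split /= -!mulr_sumr !big_split /= -!mulr_sumr -/G -/T.
  rewrite sumr_const; set v := _ ^+ q.+1 *+ _.
  suff -> : s%:R * v = B by [].
  by rewrite /v -[_ ^+ _ *+ _]mulr_natl mulrCA mulrA.
have B0 : 0 <= B by rewrite !mulr_ge0 ?exprn_ge0 // !mulr_ge0 ?sqr_ge0.
have qE : q%:R = p - 1 by rewrite /p -natr1 addrK.
have rE : q.*2.+1%:R = 2 * p - 1 :> R.
  by rewrite /p -addnn -!natr1 natrD; ring.
have p3 : 0 <= 64 * p ^+ 3 by rewrite mulr_ge0 // exprn_ge0 // (le_trans ler01 p1).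
have le2 := ler_wpM2l p3 step.
rewrite qE in le1; rewrite rE in le2.
(* A self-bounding inequality for [G]. If [G] exceeded [B], replacing [B] by [G] would contradict
   the positivity of [22 p^2 - 11 p + 16]. *)
have le3 : 64 * p ^+ 3 * G <= (2 * p - 1) *
    ((17 * p + 16) * (B + (p - 1) * G) + 4 * p ^+ 2 * G).
  apply: (le_trans le2); rewrite mulrCA; apply: ler_wpM2l; first lra.
  apply: (le_trans le1).
  have : 16 * p * ((4 * p) ^+ q.+1 * T) <= 16 * p * B.
    by rewrite ler_wpM2l // mulr_ge0 // (le_trans ler01 p1).
  lra.
rewrite leNgt; apply/negP => BG.
have G0 : 0 < G by apply: le_lt_trans BG.
have : (2 * p - 1) * ((17 * p + 16) * (B + (p - 1) * G) + 4 * p ^+ 2 * G)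
     <= (2 * p - 1) * ((17 * p + 16) * (p * G) + 4 * p ^+ 2 * G).
  rewrite ler_wpM2l ?lerD2r ?ler_wpM2l //; lra.
move/(le_trans le3); apply/negP; rewrite -ltNge -subr_gt0.
have -> : 64 * p ^+ 3 * G - (2 * p - 1) * ((17 * p + 16) * (p * G) + 4 * p ^+ 2 * G)
  = p * G * (22 * p ^+ 2 - 11 * p + 16) by ring.
by rewrite !mulr_gt0 //; nra.
Qed.

End PatternMoment.

(** * Eigenvalues and tail bound *)

Lemma sqfrob_mulmx_le (R : realFieldType) (m n q : nat) (A : 'M[R]_(m, n))
    (B : 'M[R]_(n, q)) : sqfrob (A *m B) <= sqfrob A * sqfrob B.
Proof.
rewrite -[sqfrob B]sqfrob_tr /sqfrob big_distrlr /=; apply: ler_sum => i _.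
apply: ler_sum => j _; rewrite mxE.
have := @weighted_cauchy R _ (fun=> 1) (A i) (B^~ j) (fun=> ler01); rewrite /=.
under eq_bigr do rewrite mul1r; move/le_trans; apply.
under eq_bigr do rewrite mul1r; under [X in _ * X]eq_bigr do rewrite mul1r.
by under [X in _ <= _ * X]eq_bigr do rewrite mxE.
Qed.

(** Apply [A ^+ q] to an eigenvector: the Frobenius norm is submultiplicative, and its square at
    [A ^+ q] is the trace. *)
Lemma eigenvalue_even_le_mxtrace (R : realFieldType) (n : nat) (A : 'M[R]_n)
    (mu : R) (q : nat) : A^T = A -> eigenvalue A mu ->
  mu ^+ q.*2 <= \tr (A ^+ q.*2).
Proof.
move=> sA /eigenvalueP[v vA v0]; rewrite mxtrace_even //.
have vX : v *m A ^+ q = mu ^+ q *: v.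
  elim: q => [|q IHq]; first by rewrite !expr0 mulmx1 scale1r.
  by rewrite exprSr -[_ * _]/(_ *m _) mulmxA IHq -scalemxAl vA scalerA -exprSr.
have vpos : 0 < sqfrob v.
  rewrite lt0r sqfrob_ge0 andbT; apply: contraNneq v0 => /eqP.
  rewrite /sqfrob big_ord1 psumr_eq0 => [|j _]; last exact: sqr_ge0.
  move=> /allP z; apply/eqP/rowP => j; rewrite mxE; apply/eqP.
  by rewrite -sqrf_eq0 (eqP (z j _)) // mem_index_enum.
have := sqfrob_mulmx_le v (A ^+ q); rewrite vX.
have -> : sqfrob (mu ^+ q *: v) = mu ^+ q.*2 * sqfrob v.
  rewrite /sqfrob mulr_sumr; apply: eq_bigr => i _; rewrite mulr_sumr.
  by apply: eq_bigr => j _; rewrite mxE exprMn -exprM muln2.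
by rewrite mulrC ler_pM2l.
Qed.

(** Raising [exp (-1/16) >= 15/16] to the 32nd power bounds [exp (-2)] below; repeated squaring with
    decimals rounded down checks that this is at least [1/8]. *)
Lemma expR2_le8 (R : realType) : expR 2 <= 8 :> R.
Proof.
have h : (15 / 16) ^+ 32 <= (expR 2)^-1 :> R.
  rewrite -expRN (_ : - 2 = 32%:R * (- 1 / 16)) ?expRM_natl; last by lra.
  apply: lerXn2r; rewrite ?nnegrE ?expR_ge0 //.
  by have := expR_ge1Dx (- 1 / 16 : R); lra.
have h1 : 1 / 8 <= (15 / 16) ^+ 32 :> R.
  have sq (x y : R) k : 0 <= x -> x <= (15 / 16) ^+ k -> y <= x * x ->
      y <= (15 / 16) ^+ (k + k).
    by move=> x0 xk yx; rewrite exprD; apply: (le_trans yx); rewrite ler_pM.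
  apply: (sq (355 / 1000) _ 16%N); [lra| |lra].
  apply: (sq (596 / 1000) _ 8%N); [lra| |lra].
  apply: (sq (7724 / 10000) _ 4%N); [lra| |lra].
  apply: (sq (8789 / 10000) _ 2%N); [lra| |lra].
  by rewrite expr2; lra.
by rewrite -[expR 2]invrK -[8]invrK lef_pV2 ?posrE ?invr_gt0 ?expR_gt0 //; lra.
Qed.

(* The moment order is [p = q + 1] with [2 q <= L < 2 p]; the bound [4] is
   attained by the estimate [(p^2 / (2 q^2))^p] at [q = 1]. *)
Lemma moment_order_exists (R : realType) (L : R) : 2 <= L ->
  exists q : nat, (q.+1%:R ^+ 2 / (4 * L ^+ 2)) ^+ q.+1 <= 4 * expR (- L).
Proof.
move=> L2; pose q := Num.truncn (L / 2).
have /andP[ql qu] : q%:R <= L / 2 < q.+1%:R by apply: truncn_itv; lra.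
have q1 : (0 < q)%N by rewrite -ltnS -(ltr_nat R); lra.
clearbody q; exists q; set p : R := q.+1%:R; pose r : R := p ^+ 2 / (2 * q%:R ^+ 2).
have q1' : 1 <= q%:R :> R by rewrite ler1n.
have pE : p = q%:R + 1 by rewrite /p -natr1.
have r4 : r ^+ q.+1 <= 4.
  (* For [q >= 3] already [r <= 1]; the values [q = 1] and [q = 2] are computed. *)
  have [q3|q3] := leqP 3 q.
    apply: (@le_trans _ _ 1); last lra.
    rewrite exprn_ile1 // /r ?divr_ge0 ?mulr_ge0 ?sqr_ge0 //.
    have q3' : 3 <= q%:R :> R by rewrite (ler_nat R 3).
    by rewrite ler_pdivrMr ?pE ?mul1r; [nra|nra].
  have [e|e] : q = 1%N \/ q = 2%N by lia.
    by rewrite /r pE e; lra.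
  by rewrite /r pE e; lra.
have c0 : 0 <= p ^+ 2 / (4 * L ^+ 2).
  by apply: divr_ge0; [exact: sqr_ge0 | apply: mulr_ge0 => //; exact: sqr_ge0].
have r0 : 0 <= r.
  by apply: divr_ge0; [exact: sqr_ge0 | apply: mulr_ge0 => //; exact: sqr_ge0].
have -> : 4 * expR (- L) = 4 / expR L by rewrite expRN.
rewrite ler_pdivlMr ?expR_gt0 //.
apply: le_trans r4.
(* [L < 2 p] turns [exp L] into at most [8^p]; then [2 q <= L] bounds [8 p^2 / (4 L^2)] by [r]. *)
have eL : expR L <= (expR 2) ^+ q.+1.
  rewrite -expRM_natl ler_expR; lra.
apply: (@le_trans _ _ ((p ^+ 2 / (4 * L ^+ 2)) ^+ q.+1 * 8 ^+ q.+1)).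
  apply: ler_wpM2l; first exact: exprn_ge0.
  apply: (le_trans eL); apply: lerXn2r; rewrite ?nnegrE ?expR_ge0 //.
  exact: expR2_le8.
rewrite -exprMn; apply: lerXn2r; rewrite ?nnegrE.
- exact: mulr_ge0.
- exact: r0.
rewrite /r -mulrA; apply: ler_wpM2l; first exact: sqr_ge0.
rewrite -[leRHS]mul1r ler_pdivlMr; last by nra.
rewrite -mulrA ler_pdivrMl; last by nra.
nra.
Qed.

Section PatternBand.
Variables (R : realType) (M n s : nat) (kappa : 'I_n -> 'I_s -> 'I_M).
Hypothesis kappa_injl : forall j, injective (kappa^~ j).
Hypothesis kappa_injr : forall i, injective (kappa i).

Definition pattern_mx (b : {ffun 'I_M -> bool}) : 'M[R]_(n, s) :=
  \matrix_(i, j) ((Num.sqrt n%:R)^-1 * rad R b (kappa i j)).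

Lemma pattern_mx_gram b : (0 < n)%N ->
  (pattern_mx b)^T *m pattern_mx b = 1%:M + n%:R^-1 *: gram_off R kappa b.
Proof.
move=> n0; apply/matrixP => j j'; rewrite !mxE.
have -> : \sum_i (pattern_mx b)^T j i * pattern_mx b i j'
   = n%:R^-1 * \sum_i rad R b (kappa i j) * rad R b (kappa i j').
  rewrite mulr_sumr; apply: eq_bigr => i _; rewrite !mxE mulrACA -invfM -expr2.
  by rewrite sqr_sqrtr.
have [<-|_] := eqVneq j j'; last by rewrite mul1r add0r.
under eq_bigr do rewrite rad_sqr.
by rewrite sumr_const card_ord mul0r mulr0 addr0 mulVf // pnatr_eq0 -lt0n.
Qed.

Lemma pattern_mx_eigenvalue b a : (0 < n)%N ->
  eigenvalue ((pattern_mx b)^T *m pattern_mx b) a ->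
  eigenvalue (gram_off R kappa b) (n%:R * (a - 1)).
Proof.
move=> n0 /eigenvalueP[v va v0]; apply/eigenvalueP; exists v => //.
have nz : n%:R != 0 :> R by rewrite pnatr_eq0 -lt0n.
move: va; rewrite pattern_mx_gram // mulmxDr mulmx1 -scalemxAr => /eqP.
rewrite addrC -subr_eq0 -addrA -[v - _]opprB -[X in _ *: v - X]scale1r.
rewrite -scalerBl subr_eq0 => /eqP/(congr1 (fun u => n%:R *: u)).
by rewrite !scalerA divff // scale1r.
Qed.

(** An eigenvalue [a] outside the band gives [X] the eigenvalue [n (a - 1)], of modulus greater than
    [delta n]. *)
Lemma eig_in_bandN b (delta : R) q : (0 < n)%N -> 0 < delta ->
  ~~ `[< eig_in_band (pattern_mx b) delta >] ->
  (delta * n%:R) ^+ q.*2 <= \tr (gram_off R kappa b ^+ q.*2).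
Proof.
move=> n0 d0 /asboolPn /existsNP[a /not_implyP[/(pattern_mx_eigenvalue n0) ea] ].
move=> /negP; rewrite -ler_distlC -ltNge distrC => da.
apply: le_trans (eigenvalue_even_le_mxtrace q (gram_off_sym _ _ _) ea).
rewrite -!mul2n !exprM lerXn2r ?nnegrE ?sqr_ge0 //.
have dn0 : 0 <= delta * n%:R by rewrite mulr_ge0 // ltW.
rewrite -[leRHS]real_normK ?num_real // ler_sqr ?nnegrE ?normr_ge0 //.
by rewrite normrM ger0_norm // mulrC ler_wpM2l // ltW.
Qed.

Lemma pattern_eig_in_band (eps delta : R) :
  0 < eps < 1 -> 0 < delta < 1 ->
  (4 * pi ^+ 2) * delta ^-2 * s%:R * (ln (4 * s%:R / eps)) ^+ 2 <= n%:R ->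
  1 - eps <= @bern_prob R _ (fun b : {ffun 'I_M -> bool} =>
               `[< eig_in_band (pattern_mx b) delta >]).
Proof.
move=> /andP[e0 e1] /andP[d0 d1] hn; rewrite /bern_prob.
set T : R := #|{: {ffun 'I_M -> bool}}|%:R; set E := (X in finset X).
have T0 : 0 < T by rewrite ltr0n; apply/card_gt0P; exists [ffun=> true].
rewrite ler_pdivlMr // mulrBl mul1r.
have TE : T = #|[set b | E b]|%:R + #|[set b | ~~ E b]|%:R.
  rewrite -natrD; congr _%:R; rewrite -(cardsC [set b | E b]).
  by congr (_ + _)%N; apply: eq_card => b; rewrite !inE.
rewrite lerBlDr {1}TE lerD2l.
(* The moment bound requires [s > 1]. For [s = 0] there are no eigenvectors; for [s = 1] the chaos
   vanishes and the only eigenvalue is 1. *)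
have [s1|s1] := leqP s 1.
  rewrite eq_card0 ?mulr_ge0 ?ltW // => b.
  rewrite !inE; apply/negbTE; rewrite negbK /E; apply/asboolP => a ea.
  have s1' : s = 1%N.
    apply/eqP; rewrite eqn_leq s1 lt0n; apply/eqP => s0.
    by have /eigenvalueP[v _ /rV0Pn[j _]] := ea; have := ltn_ord j; lia.
  have n0 : (0 < n)%N.
    rewrite -(ltr0n R); apply: lt_le_trans hn; rewrite s1' mulr1.
    by rewrite !mulr_gt0 ?exprn_gt0 ?pi_gt0 ?invr_gt0 ?exprn_gt0 ?ln_gt0 //
      ltr_pdivlMr //; lra.
  have X0 : gram_off R kappa b = 0.
    apply/matrixP => j j'; rewrite !mxE.
    have -> : j = j' by apply: ord_inj; have := ltn_ord j; have := ltn_ord j'; lia.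
    by rewrite eqxx mul0r.
  have /eigenvalueP[v] := pattern_mx_eigenvalue n0 ea.
  rewrite X0 mulmx0 => /esym/eqP; rewrite scaler_eq0 => /orP[|/eqP-> /eqP //].
  by rewrite mulf_eq0 pnatr_eq0 -leqn0 leqNgt n0 /= subr_eq0 => /eqP-> _; lra.
set L := ln _ in hn.
have s2 : 2 <= s%:R :> R by rewrite ler_nat.
have se0 : 0 < 4 * s%:R / eps by rewrite divr_gt0 //; lra.
(* Here [4 s / eps >= 8 >= exp 2]. *)
have L2 : 2 <= L.
  rewrite -[2]expRK ler_ln ?posrE ?expR_gt0 //; apply: (le_trans (expR2_le8 R)).
  by rewrite ler_pdivlMr //; nra.
have [q hq] := moment_order_exists L2.
(* Since [pi >= 2], the constant [4 pi^2] is at least 16. *)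
have hn1 : 16 * s%:R * L ^+ 2 <= delta ^+ 2 * n%:R.
  rewrite [leRHS]mulrC -ler_pdivrMr ?exprn_gt0 //; apply: le_trans hn.
  have pi4 : 4 <= pi ^+ 2 :> R by have := pi_ge2 R; nra.
  have -> : 16 * s%:R * L ^+ 2 / delta ^+ 2 = 4 * (4 * (delta ^- 2 * s%:R * L ^+ 2)).
    by ring.
  have -> : 4 * pi ^+ 2 * delta ^- 2 * s%:R * L ^+ 2
      = 4 * (pi ^+ 2 * (delta ^- 2 * s%:R * L ^+ 2)) by ring.
  apply: ler_wpM2l => //; apply: ler_wpM2r => //.
  apply: mulr_ge0; last exact: sqr_ge0.
  by apply: mulr_ge0 => //; rewrite invr_ge0 sqr_ge0.
have n64 : (64 * s <= n)%N.
  rewrite -(ler_nat R) natrM.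
  have h1 : 64 * s%:R <= 16 * s%:R * L ^+ 2.
    have L4 : 4 <= L ^+ 2 by nra.
    have := ler_wpM2l (ler0n R s) L4; lra.
  apply: (le_trans h1); apply: (le_trans hn1).
  by rewrite ler_piMl // expr_le1 // ltW.
have n0 : (0 < n)%N by apply: leq_trans n64; rewrite muln_gt0 (ltnW s1).
have n0' : 0 < n%:R :> R by rewrite ltr0n.
have L0 : 0 < L by lra.
set p : R := q.+1%:R in hq.
have dn : 0 < delta * n%:R by rewrite mulr_gt0.
(* Markov's inequality, in counting form, for the nonnegative variable [tr X^(2p)]. *)
have markov : #|[set b | ~~ E b]|%:R * (delta * n%:R) ^+ q.+1.*2
    <= \sum_b \tr (gram_off R kappa b ^+ q.+1.*2).
  apply: (@le_trans _ _ (\sum_(b | ~~ E b) (delta * n%:R) ^+ q.+1.*2)).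
    by rewrite sumr_const -[leRHS]mulr_natl cardsE.
  rewrite [leRHS](bigID (fun b => ~~ E b)) /= -[leLHS]addr0; apply: lerD.
    by apply: ler_sum => b; apply: eig_in_bandN.
  apply: sumr_ge0 => b _; rewrite mxtrace_even ?gram_off_sym //.
  exact: sqfrob_ge0.
have mom := gram_off_moment R kappa_injl kappa_injr q s1 n64.
rewrite -/T -/p in mom.
have le1 : (4 * p ^+ 2 * (n * s)%:R) ^+ q.+1
    <= 4 * expR (- L) * (delta * n%:R) ^+ q.+1.*2.
  apply: le_trans (ler_wpM2r (exprn_ge0 _ (ltW dn)) hq).
  rewrite -mul2n exprM -exprMn; apply: lerXn2r; rewrite ?nnegrE.
  - by apply: mulr_ge0 => //; apply: mulr_ge0 => //; exact: sqr_ge0.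
  - apply: mulr_ge0; last exact: sqr_ge0; apply: divr_ge0; first exact: sqr_ge0.
    by apply: mulr_ge0 => //; exact: sqr_ge0.
  rewrite [leRHS]mulrAC ler_pdivlMr; last by rewrite mulr_gt0 // exprn_gt0.
  have -> : 4 * p ^+ 2 * (n * s)%:R * (4 * L ^+ 2)
     = p ^+ 2 * n%:R * (16 * s%:R * L ^+ 2) by rewrite natrM; ring.
  have -> : p ^+ 2 * (delta * n%:R) ^+ 2 = p ^+ 2 * n%:R * (delta ^+ 2 * n%:R) by ring.
  by rewrite ler_wpM2l // mulr_ge0 // sqr_ge0.
(* The 4 inside the logarithm absorbs the loss from [moment_order_exists], and [s] absorbs the
   dimension factor of the trace. *)
have epsE : eps = s%:R * (4 * expR (- L)).
  rewrite /L expRN lnK ?posrE // invf_div; field.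
  by rewrite gt_eqF ?ltr0n ?(ltnW s1).
rewrite -(ler_pM2r (exprn_gt0 q.+1.*2 dn)); apply: (le_trans markov).
apply: (le_trans mom).
set z := (delta * _) ^+ _ in le1 *.
have -> : eps * T * z = T * s%:R * (4 * expR (- L) * z) by rewrite {1}epsE; ring.
by rewrite ler_wpM2l // mulr_ge0 // ltW.
Qed.

End PatternBand.

(** * Circulant and Toeplitz index patterns *)

Lemma circulant_index_injr (N : nat) (c : 'I_N) :
  injective (fun a : 'I_N => (a + N - c) %% N)%N.
Proof.
move=> a b /eqP; rewrite -(eqn_modDr c).
rewrite !subnK ?(leq_trans (ltnW (ltn_ord c))) ?leq_addl //.
by rewrite eqn_modDr !modn_small // => /eqP/ord_inj.
Qed.

Lemma circulant_index_injl (N : nat) (c : 'I_N) :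
  injective (fun a : 'I_N => (c + N - a) %% N)%N.
Proof.
have le (a : 'I_N) : (a <= c + N)%N by rewrite (leq_trans (ltnW (ltn_ord a))) ?leq_addl.
move=> a b /eqP; rewrite -(eqn_modDr a) subnK // -{1}(subnK (le b)).
by rewrite eqn_modDl !modn_small // => /eqP/ord_inj.
Qed.

Lemma sgn_at_rad (R : realType) (m : nat) (v : {ffun 'I_m -> bool}) (k : nat)
  (km : (k < m)%N) : sgn_at R v k = rad R v (Ordinal km).
Proof. by rewrite /sgn_at insubT. Qed.

Theorem theorem5 (R : realType) (N n s : nat) (Om La : {set 'I_N})
  (eps delta : R) :
  #|Om| = n -> #|La| = s ->
  0 < eps < 1 -> 0 < delta < 1 ->
  (4 * pi ^+ 2) * delta ^-2 * s%:R * (ln (4 * s%:R / eps)) ^+ 2 <= n%:R ->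
  1 - eps <= @bern_prob R _ (fun b : {ffun 'I_N -> bool} =>
               `[< eig_in_band (submx_scaled n (circulant R b) Om La) delta >])
  /\
  1 - eps <= @bern_prob R _ (fun c : {ffun 'I_(N.*2.-1) -> bool} =>
               `[< eig_in_band (submx_scaled n (toeplitz R c) Om La) delta >]).
Proof.
move=> <- <- he hd hn; split.
  (* The index is in range, so the default value 0 of [sgn_at] never occurs. *)
  have lt (i : 'I_#|Om|) (j : 'I_#|La|) :
      ((enum_val j + N - enum_val i) %% N < N)%N.
    by rewrite ltn_mod (leq_ltn_trans _ (ltn_ord (enum_val i))).
  pose kappa i j := Ordinal (lt i j).
  have eA b : submx_scaled #|Om| (circulant R b) Om La = pattern_mx R kappa b.
    by apply/matrixP => i j; rewrite !mxE (sgn_at_rad R b (lt i j)).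
  have -> : (fun b => `[< eig_in_band (submx_scaled #|Om| (circulant R b) Om La) delta >])
      = (fun b => `[< eig_in_band (pattern_mx R kappa b) delta >]).
    by apply/funext => b; rewrite eA.
  apply: pattern_eig_in_band he hd hn => [j i i'|i j j'] /(congr1 val) /=.
    by move/circulant_index_injl/enum_val_inj.
  by move/circulant_index_injr/enum_val_inj.
have lt (i : 'I_#|Om|) (j : 'I_#|La|) :
    (enum_val j + N.-1 - enum_val i < N.*2.-1)%N.
  by have := ltn_ord (enum_val i); have := ltn_ord (enum_val j); lia.
pose kappa i j := Ordinal (lt i j).
have eA b : submx_scaled #|Om| (toeplitz R b) Om La = pattern_mx R kappa b.
  by apply/matrixP => i j; rewrite !mxE (sgn_at_rad R b (lt i j)).
have -> : (fun b => `[< eig_in_band (submx_scaled #|Om| (toeplitz R b) Om La) delta >])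
    = (fun b => `[< eig_in_band (pattern_mx R kappa b) delta >]).
  by apply/funext => b; rewrite eA.
(* Row indices are at most [N - 1], so the natural subtraction never truncates and the index is
   injective in each variable. *)
apply: pattern_eig_in_band he hd hn => [j i i'|i j j'] /(congr1 val) /= e;
  apply: enum_val_inj; apply: ord_inj; move: e.
  have := ltn_ord (enum_val i); have := ltn_ord (enum_val i').
  have := ltn_ord (enum_val j); lia.
have := ltn_ord (enum_val j); have := ltn_ord (enum_val j').
have := ltn_ord (enum_val i); lia.
Qed.
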